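(* Let $p_K^{\mathrm{SWT}}(t)$ denote the maximal transience probability at time $t$ of the SSEP with traps on the ring with $K$ sites. Then $$\lim_{t\to+\infty}\ \sup_{K\ge 1}\ p_K^{\mathrm{SWT}}\big(tK^2\log K\big)=0 .$$
   Context: For an integer $K\ge 1$ let $\mathbb{T}_K=\{1,\dots,K\}$ be the periodic ring (indices mod $K$) and $\Gamma_K=\{n\in\mathbb{Z}: n\le 1\}^{\mathbb{T}_K}$. For $\xi\in\Gamma_K$: $\xi_k=1$ means site $k$ holds a (live) particle, $\xi_k=0$ means it is empty, $\xi_k<0$ means it holds a trap of depth $|\xi_k|$. The SSEP with traps (SWT) on $\mathbb{T}_K$ is the continuous-time Markov process on $\Gamma_K$ with generator $$\mathscr{L}f(\xi)=\sum_{k\in\mathbb{T}_K}\sum_{z=\pm1}\mathbf{1}_{\{\xi_k=1,\ \xi_{k+z}\le 0\}}\{f(\xi^{k,k+z})-f(\xi)\},$$ where $\xi^{k,k+z}$ equals $0$ at $k$, $\xi_{k+z}+1$ at $k+z$, and $\xi_{k'}$ at every other site $k'$. Let $\mathbf{P}^K_\xi$ be its law started from $\xi$. Set $|\xi^-|=-\sum_k\min(\xi_k,0)$ and $|\xi^+|=\sum_k\mathbf{1}_{\{\xi_k=1\}}$. The set of transient configurations is $\mathcal{T}_K^{\mathrm{SWT}}=\{\xi\in\Gamma_K: |\xi^-|>0,\ |\xi^+|>0\}$. For $\xi\in\Gamma_K$ let $p_\xi(t)=\mathbf{P}^K_\xi(\xi(t)\in\mathcal{T}_K^{\mathrm{SWT}})$,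 and let $p_K^{\mathrm{SWT}}(t)=\sup\{p_\xi(t):\xi\in\Gamma_K\}$. *)

(* Defs.v *)
From HB Require Import structures.
From mathcomp Require Import all_boot all_order all_algebra.
From mathcomp Require Import all_classical all_reals all_analysis.
Set Implicit Arguments.
Unset Strict Implicit.
Unset Printing Implicit Defensive.
Import Order.TTheory GRing.Theory Num.Theory.
Import numFieldNormedType.Exports.
Local Open Scope classical_set_scope.
Local Open Scope ring_scope.

Section MarkovProcess.
Context {R : realType} {d : measure_display} {Omega : measurableType d}.
Context {E : countType}.
Implicit Types (P : E -> probability Omega R) (X : R -> Omega -> E).

(* The sigma-algebra generated by (X_u), 0 <= u <= s; E is discrete. *)
Definition history X (s : R) : set (set Omega) :=
  <<s [set F | exists u A, [/\ 0 <= u, u <= s & F = X u @^-1` A]] >>.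

(* P x is the law of the process started from x. Only the values of X at      *)
(* nonnegative times matter.                                                  *)
(* - mp_markov is P_x (X_(s + t) \in B | F_s) = P_(X_s) (X_t \in B), written  *)
(*   without conditional expectations since E is countable.                   *)
(* - mp_generator says that L is the derivative at 0 of the semigroup of X,   *)
(*   in sup norm; the domain is the space of all bounded functions, which is  *)
(*   appropriate for generators with bounded jump rates only.                 *)
Record markov_process_with_generator P X (L : (E -> R) -> E -> R) : Prop := {
  mp_measurable : forall (t : R) (A : set E), 0 <= t ->
    measurable (X t @^-1` A) ;
  mp_start : forall x : E, P x (X 0 @^-1` [set x]) = 1%E ;
  mp_markov : forall (x y : E) (s t : R) (F : set Omega) (B : set E),
    0 <= s -> 0 <= t -> history X s F ->
    (P x (F `&` X s @^-1` [set y] `&` X (s + t)%R @^-1` B) =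
     P x (F `&` X s @^-1` [set y]) * P y (X t @^-1` B))%E ;
  mp_generator : forall f : E -> R, (exists M : R, forall x, `|f x| <= M) ->
    forall e : R, 0 < e -> \forall h \near 0^'+, forall x : E,
      `|(fine 'E_(P x)[f \o X h] - f x) / h - L f x| <= e }.

End MarkovProcess.

Section SSEPWithTraps.
Context {K : nat}.

Definition conf := {xi : {ffun 'I_K -> int} | [forall k, xi k <= 1]}.

Definition height (xi : conf) (k : 'I_K) : int := val xi k.

Definition jump_fun (xi : conf) (k j : 'I_K) : {ffun 'I_K -> int} :=
  [ffun i => if i == k then 0 else if i == j then height xi j + 1
             else height xi i].

(* The default value xi is never used in the generator: see val_jump. *)
Definition jump (xi : conf) (k j : 'I_K) : conf := insubd xi (jump_fun xi k j).

Lemma val_jump (xi : conf) (k j : 'I_K) :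
  height xi j <= 0 -> val (jump xi k j) = jump_fun xi k j.
Proof.
move=> hj; rewrite /jump insubdK //.
apply/forallP => i; rewrite ffunE.
case: ifP => // _; case: ifP => // _; first by rewrite -lerBrDr subrr.
by have /forallP := valP xi; apply.
Qed.

(* ordS k and ord_pred k are k + 1 and k - 1 modulo K; they are both counted  *)
(* even when they coincide (K <= 2).                                          *)
Definition SWT_generator {R : realType} (f : conf -> R) (xi : conf) : R :=
  \sum_(k < K) \sum_(j <- [:: ordS k; ord_pred k])
    ((height xi k == 1) && (height xi j <= 0))%:R * (f (jump xi k j) - f xi).

Definition neg_mass (xi : conf) : int := - \sum_(k < K) Num.min (height xi k) 0.

Definition pos_mass (xi : conf) : nat := (\sum_(k < K) (height xi k == 1))%N.

Definition transient : set conf :=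
  [set xi | (0 < neg_mass xi) /\ (0 < pos_mass xi)%N].

End SSEPWithTraps.
Arguments conf : clear implicits.

Section TransienceProbability.
Context {R : realType} {d : measure_display} {Omega : measurableType d}.
Context {K : nat}.
Implicit Types (P : conf K -> probability Omega R) (X : R -> Omega -> conf K).

Definition is_SWT P X : Prop :=
  markov_process_with_generator P X SWT_generator.

Definition transience_prob P X (xi : conf K) (t : R) : \bar R :=
  P xi (X t @^-1` transient).

Definition max_transience_prob P X (t : R) : \bar R :=
  ereal_sup [set transience_prob P X xi t | xi in [set: conf K]].

End TransienceProbability.

(* Main.v *)
Require Import Defs.
From mathcomp Require Import all_boot all_order all_algebra.
From mathcomp Require Import all_classical all_reals all_analysis.
From mathcomp Require Import measurable_realfun.
From mathcomp Require Import zify lra ring.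
Set Implicit Arguments.
Unset Strict Implicit.
Unset Printing Implicit Defensive.
Import Order.TTheory GRing.Theory Num.Theory.
Import numFieldNormedType.Exports.
Local Open Scope classical_set_scope.
Local Open Scope ring_scope.

(** Traps get filled, but no trap is ever created. So a particle and a trap that coexist at time t have coexisted,
    apart, since time 0, and during all that time the particle has avoided the
    trap. Up to exchanging live particles when they meet, each particle is a
    simple random walk until it is absorbed, and such a walk avoids a given
    site of the ring during time t with probability exp(- c t / K^2) at most,
    up to a factor polynomial in K. There are at most K^2 pairs made of a
    particle and a trap, which is why time of order K^2 log K is enough.

    The argument is run here at the level of expectations, with a Lyapunov
    function instead of labelled walks. Let [energy xi] be the sum, over the
    traps i and the live particles k of xi, of m (K - m) with m = |k - i|. This
    weight vanishes at the trap, and its discrete Laplacian on the ring is -2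
    at all other sites; as the weight is at most K^2, it is a strict
    supersolution for the walk killed at i, with rate 2 / K^2. The exclusion
    rule does not disturb this, because the current between two neighbours is
    a gradient: the terms in which both sites are live cancel by antisymmetry
    ([big_ordS_pred]). Hence L energy <= - (2 / K^2) energy
    ([generator_energy]).

    The generator being the uniform derivative at 0 of the semigroup, this
    inequality yields E [energy (X_t)] <= exp (- 2 t / K^2) energy (X_0)
    ([exponential_decay]): time t is cut into n equal steps, each of which
    contracts the expectation up to an error o(1/n). Since the energy is at
    least 1 on transient configurations and at most K^4 everywhere, the
    transience probability at time t K^2 log K is at most K^(4 - 2 t), hence at
    most 2^(- t) as soon as K >= 2 and t >= 4; a ring with one site has no
    transient configuration at all. *)

(** * Lyapunov functions of countable Markov processes *)

Section MarkovProcesses.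
Context {R : realType} {d : measure_display} {Omega : measurableType d}.
Context {E : countType}.
Context {P : E -> probability Omega R} {X : R -> Omega -> E}.
Context {L : (E -> R) -> E -> R}.
Context (XP : markov_process_with_generator P X L).
Implicit Types (f : E -> nat) (x y : E) (s t : R).

Lemma measurable_observable (D : set Omega) f t : 0 <= t ->
  measurable_fun D (EFin \o (fun w => (f (X t w))%:R : R)).
Proof.
move=> t0; apply/measurable_EFinP => mD U mU.
apply: measurableI => //.
by have := mp_measurable XP ((fun y => (f y)%:R : R) @^-1` U) t0.
Qed.

(** Layer-cake formula. It reduces expectations of bounded observables to
    probabilities, which is the form in which the Markov property is known. *)
Lemma integral_observable (D : set Omega) f (M : nat) x t : measurable D ->
  0 <= t -> (forall y, (f y <= M)%N) ->
  (\int[P x]_(w in D) (f (X t w))%:R%:E =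
   \sum_(v < M) P x (D `&` X t @^-1` [set y | v < f y]%N))%E.
Proof.
move=> mD t0 fM.
have mA (v : 'I_M) : measurable (X t @^-1` [set y | v < f y]%N).
  exact: (mp_measurable XP _ t0).
transitivity (\int[P x]_(w in D)
    \sum_(v < M) (\1_(X t @^-1` [set y | v < f y]%N) w)%:E)%E.
  apply: eq_integral => w _; rewrite sumEFin; congr EFin.
  rewrite -[in LHS](card_ord (f (X t w))) -sum1_card natr_sum.
  rewrite (big_ord_widen_cond M (fun=> true) (fun=> 1)) //= big_mkcond /=.
  apply: eq_bigr => v _; rewrite indicE.
  case: ifPn => h; first by rewrite mem_set.
  by rewrite memNset //= => /(elimN idP h).
rewrite ge0_integral_sum //; last first.
- move=> v; apply/measurable_EFinP; apply: measurable_indic.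
  exact: mA.
apply: eq_bigr => v _; rewrite integral_indic// setIC//.
Qed.

Lemma markov_property_at x y s t (B : set E) : 0 <= s -> 0 <= t ->
  (P x (X s @^-1` [set y] `&` X (s + t)%R @^-1` B) =
   P x (X s @^-1` [set y]) * P y (X t @^-1` B))%E.
Proof.
move=> s0 t0; have hT : history X s setT.
  by have [h0 hC _] := smallest_sigma_algebra setT
    [set F | exists u A, [/\ 0 <= u, u <= s & F = X u @^-1` A]];
  rewrite -(setD0 setT); exact: hC.
by have := mp_markov XP x y B s0 t0 hT; rewrite setTI.
Qed.

Lemma integral_restart f (M : nat) x y s t : 0 <= s -> 0 <= t ->
  (forall z, (f z <= M)%N) ->
  (\int[P x]_(w in X s @^-1` [set y]) (f (X (s + t)%R w))%:R%:E =
   P x (X s @^-1` [set y]) * \int[P y]_w (f (X t w))%:R%:E)%E.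
Proof.
move=> s0 t0 fM.
rewrite (integral_observable _ _ _ fM) ?addr_ge0//; last exact: (mp_measurable XP _ s0).
rewrite (integral_observable _ _ _ fM)// ge0_sume_distrr//.
by apply: eq_bigr => v _; rewrite setTI markov_property_at.
Qed.

Let integral_constant x (c : R) : (\int[P x]_w cst c%:E w = c%:E)%E.
Proof.
transitivity (c%:E * P x setT)%E; first exact: integral_cst.
by rewrite probability_setT mule1.
Qed.

(** Summing [integral_restart] over the countably many values of X_s: an affine
    bound on the expectation after time t, uniform in the starting point, can be
    applied to the process restarted at time s. *)
Lemma integral_restart_le f (M : nat) (a b s t : R) x :
  0 <= s -> 0 <= t -> 0 <= a -> 0 <= b -> (forall z, (f z <= M)%N) ->
  (forall y, \int[P y]_w (f (X t w))%:R%:E <= (a * (f y)%:R + b)%:E)%E ->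
  (\int[P x]_w (f (X (s + t)%R w))%:R%:E <=
   a%:E * \int[P x]_w (f (X s w))%:R%:E + b%:E)%E.
Proof.
move=> s0 t0 a0 b0 fM step.
have st0 : 0 <= s + t by exact: addr_ge0.
pose g w : \bar R := (a%:E * (f (X s w))%:R%:E + b%:E)%E.
have mg D : measurable_fun D g.
  apply: emeasurable_funD => //; apply: measurable_funeM.
  exact: (measurable_observable f s0).
have g0 w : (0 <= g w)%E by rewrite adde_ge0// mule_ge0// lee_fin.
have -> : (a%:E * \int[P x]_w (f (X s w))%:R%:E + b%:E = \int[P x]_w g w)%E.
  rewrite ge0_integralD//; last 2 first.
  - by move=> w _; rewrite mule_ge0// lee_fin.
  - by apply: measurable_funeM; exact: (measurable_observable f s0).
  rewrite ge0_integralZl ?lee_fin//; last exact: (measurable_observable f s0).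
  by rewrite integral_constant.
(* The pieces {X_s = y}, indexed by nat; D n is empty if n encodes no state. *)
pose D n := X s @^-1` [set y | pickle y = n].
have mD n : measurable (D n) by exact: (mp_measurable XP _ s0).
have DT : \bigcup_n D n = setT.
  by apply/seteqP; split => // w _; exists (pickle (X s w)).
have tD : trivIset setT D.
  by move=> m n _ _ [w [/= <- <-]].
rewrite -DT !ge0_integral_bigcup//; last refine (@measurable_observable _ f _ st0).
apply: lee_nneseries => [n _ _|n _].
  by apply: integral_ge0 => w _; rewrite lee_fin.
have [[y yn]|Dn0] := pselect (exists y : E, pickle y = n); last first.
  rewrite (_ : D n = set0) ?integral_set0//.
  by apply/seteqP; split => // w /= Dw; apply: Dn0; exists (X s w).
have Dy : D n = X s @^-1` [set y].
  apply/seteqP; split => w /=; rewrite /D /= -yn; last by move=> ->.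
  exact: (pcan_inj pickleK).
have -> : (\int[P x]_(w in D n) g w = P x (D n) * (a * (f y)%:R + b)%:E)%E.
  transitivity (\int[P x]_(w in D n) cst (a * (f y)%:R + b)%:E w)%E.
    by apply: eq_integral => w; rewrite inE Dy /= /g => ->.
  by rewrite integral_cst// muleC.
rewrite Dy (integral_restart _ _ _ _ fM)//.
exact: lee_wpmul2l.
Qed.

Lemma integral_time0 f x : (\int[P x]_w (f (X 0 w))%:R%:E = (f x)%:R%:E)%E.
Proof.
have mA := mp_measurable XP [set x] (lexx 0).
have P1 := mp_start XP x.
transitivity (\int[P x]_w (cst (f x)%:R%:E w))%E; last first.
  by rewrite integral_constant.
apply: ae_eq_integral => //; first exact: (measurable_observable f (lexx 0)).
exists (~` (X 0 @^-1` [set x])); split.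
- exact: measurableC.
- by apply: etrans (probability_setC (P x) mA) _; rewrite P1 subee.
- by apply: subsetC => w /= ->.
Qed.

(** Discrete Gronwall argument. For every h small enough, the derivative of the
    semigroup at 0 gives E_y[f (X_h)] <= (1 - lam h) f y + h e / t uniformly in
    y. Iterating this n + 1 times with h = t / (n + 1) yields the bound
    (1 - lam h)^(n + 1) f x + e, and 1 - lam h <= exp (- lam h). *)
Lemma exponential_decay f (M : nat) (lam : R) x t : 0 <= lam -> 0 <= t ->
  (forall z, (f z <= M)%N) ->
  (forall z, L (fun y => (f y)%:R) z <= - lam * (f z)%:R) ->
  (\int[P x]_w (f (X t w))%:R%:E <= (expR (- (lam * t)) * (f x)%:R)%:E)%E.
Proof.
move=> lam0 t0 fM Lf.
have [->|tneq0] := eqVneq t 0.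
  by rewrite integral_time0 mulr0 oppr0 expR0 mul1r.
have tp : 0 < t by rewrite lt_neqAle eq_sym tneq0.
apply/lee_addgt0Pr => e e0.
have et0 : 0 < e / t by rewrite divr_gt0.
have fb : exists M' : R, forall z, `|(f z)%:R : R| <= M'.
  by exists M%:R => z; rewrite normr_nat ler_nat.
have gen := mp_generator XP fb et0.
have [/= r r0 near_r] := gen.
(* n is large enough for the generator estimate to hold at h (h < r), and for
   the contraction factor 1 - lam * h to be nonnegative. *)
pose n := Num.truncn (t / Num.min r (lam + 1)^-1).
pose h := t / n.+1%:R.
have lam1 : 0 < lam + 1 by rewrite ltr_wpDl.
have m0 : 0 < Num.min r (lam + 1)^-1 by rewrite lt_min r0 invr_gt0.
have h0 : 0 < h by rewrite divr_gt0.
have hm : h < Num.min r (lam + 1)^-1.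
  rewrite /h ltr_pdivrMr// mulrC -ltr_pdivrMr//.
  exact: Num.Theory.truncnS_gt.
have lamh : 0 <= 1 - lam * h.
  rewrite subr_ge0; move: hm; rewrite lt_min => /andP[_].
  rewrite -(ltr_pM2l lam1) mulfV ?gt_eqF// => h1.
  by rewrite (le_trans _ (ltW h1))// ler_pM2r// lerDl.
have step y : (\int[P y]_w (f (X h w))%:R%:E <=
    ((1 - lam * h) * (f y)%:R + h * (e / t))%:E)%E.
  have := near_r h; rewrite /= sub0r normrN gtr0_norm//.
  move: hm; rewrite lt_min => /andP[hr _] /(_ hr h0 y).
  rewrite unlock.
  have -> : (\int[P y]_w (((fun z => (f z)%:R) \o X h) w)%:E =
      (fine (\int[P y]_w (f (X h w))%:R%:E))%:E)%E.
    rewrite fineK// ge0_fin_numE; last first.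
      by apply: integral_ge0 => w _; rewrite lee_fin.
    rewrite (integral_observable _ _ (ltW h0) fM)//.
    apply/lte_sum_pinfty => v _; rewrite setTI.
    by rewrite (le_lt_trans (probability_le1 _ _)) ?ltry//; exact: (mp_measurable XP _ (ltW h0)).
  rewrite /= lee_fin; set u := fine _.
  move=> /ler_normlW; rewrite lerBlDr ler_pdivrMr// lerBlDr => /le_trans; apply.
  have := ler_wpM2r (ltW h0) (Lf y); lra.
have it m : (\int[P x]_w (f (X (m%:R * h) w))%:R%:E <=
    ((1 - lam * h) ^+ m * (f x)%:R + m%:R * h * (e / t))%:E)%E.
  elim: m => [|m IHm]; first by rewrite !mul0r integral_time0 expr0 mul1r addr0.
  have mh0 : 0 <= m%:R * h by rewrite mulr_ge0// ltW.
  have eh0 : 0 <= h * (e / t) by rewrite mulr_ge0// ltW.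
  rewrite -[m.+1]addn1 natrD mulrDl mul1r.
  apply: le_trans (integral_restart_le x mh0 (ltW h0) lamh eh0 fM step) _.
  apply: (@le_trans _ _ ((1 - lam * h)%:E * ((1 - lam * h) ^+ m * (f x)%:R + m%:R * h * (e / t))%:E + (h * (e / t))%:E)%E).
    by rewrite leeD2r// lee_wpmul2l// lee_fin.
  rewrite -EFinM -EFinD lee_fin mulrDr mulrA addn1 -exprS -addrA lerD2l.
  rewrite (mulrDl _ _ (e / t)) lerD2r -[leRHS]mul1r ler_wpM2r//.
    by rewrite mulr_ge0// ltW.
  by rewrite lerBlDr lerDl mulr_ge0// ltW.
have nh : n.+1%:R * h = t by rewrite /h mulrC divfK.
have := it n.+1; rewrite nh => /le_trans; apply.
have -> : t * (e / t) = e by rewrite mulrC divfK.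
rewrite -EFinD lee_fin lerD2r ler_wpM2r//.
have -> : - (lam * t) = n.+1%:R * - (lam * h) by rewrite -nh mulrN mulrCA.
rewrite expRM_natl.
rewrite lerXn2r// ?nnegrE ?expR_ge0//.
by have := expR_ge1Dx (- (lam * h)).
Qed.

End MarkovProcesses.

(** * The energy of a configuration *)

Section Lyapunov.
Context {K : nat}.
Implicit Types (xi : conf K) (i j k l : 'I_K).

(** m (K - m) for m = |k - i|, written with truncated subtraction. It does not
    change under m -> K - m, so that it is a function on the ring. *)
Definition parabola k i : nat := (maxn k i - minn k i) * (K - (maxn k i - minn k i)).

Lemma parabola_id i : parabola i i = 0%N.
Proof. by rewrite /parabola maxnn minnn subnn. Qed.

Lemma parabola_gt0 k i : k != i -> (0 < parabola k i)%N.
Proof.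
have := ltn_ord k; have := ltn_ord i; rewrite /parabola -val_eqE /= muln_gt0.
lia.
Qed.

Lemma parabola_le k i : (parabola k i <= K ^ 2)%N.
Proof.
have := ltn_ord k; have := ltn_ord i; rewrite /parabola -mulnn => ? ?.
by apply: leq_mul; lia.
Qed.

(** Along the ring cut open at i, the weight is a quadratic polynomial of
    leading coefficient -1. The additive 2 on the left keeps the
    identity in nat. *)
Lemma parabola_laplacian k i : k != i ->
  (parabola (ordS k) i + parabola (ord_pred k) i + 2 = 2 * parabola k i)%N.
Proof.
rewrite -val_eqE /parabola /=.
have := ltn_ord k; have := ltn_ord i.
(* In each case, r + 1 is the distance from a to b, and c + 1 is the distance
   from the larger of them to K; wrapping around is treated apart. *)
move: (nat_of_ord k) (nat_of_ord i) => {k i} a b bK aK ab.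
have succE m : m.+1 = K -> (m.+1 %% K = 0)%N by move=> ->; rewrite modnn.
have predE m : (m < K)%N -> (0 < m)%N -> ((m + K).-1 %% K = m.-1)%N.
  move=> mK m0; rewrite (_ : (m + K).-1 = m.-1 + K)%N; last lia.
  by rewrite modnDr modn_small//; lia.
have pred0 : ((0 + K).-1 %% K = K.-1)%N by rewrite modn_small//; lia.
have [lt_ab|lt_ba|/eqP] := ltngtP a b; last by rewrite (negbTE ab).
- have [r rE] : exists r, (b = a + r.+1)%N by exists (b - a).-1; lia.
  have [c KE] : exists c, (K = b + c.+1)%N by exists (K - b).-1; lia.
  rewrite (@modn_small a.+1); last lia.
  have -> : (maxn a.+1 b - minn a.+1 b = r)%N by lia.
  have -> : (b - a = r.+1)%N by lia.
  case: a => [|a] in aK ab lt_ab rE *.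
    rewrite pred0.
    have -> : (maxn K.-1 b - minn K.-1 b = c)%N by lia.
    have -> : (K - r = c.+2)%N by lia.
    have -> : (K - r.+1 = c.+1)%N by lia.
    have -> : (K - c = r.+2)%N by lia.
    by ring.
  rewrite predE//.
  have -> : (maxn a.+1.-1 b - minn a.+1.-1 b = r.+2)%N by lia.
  have -> : (K - r = a.+1 + c.+2)%N by lia.
  have -> : (K - r.+1 = a.+1 + c.+1)%N by lia.
  have -> : (K - r.+2 = a.+1 + c)%N by lia.
  by ring.
- have [r rE] : exists r, (a = b + r.+1)%N by exists (a - b).-1; lia.
  have [c KE] : exists c, (K = a + c.+1)%N by exists (K - a).-1; lia.
  rewrite predE//; last lia.
  have -> : (maxn a.-1 b - minn a.-1 b = r)%N by lia.
  have -> : (a - b = r.+1)%N by lia.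
  case: c => [|c] in KE *.
    rewrite succE; last lia.
    have -> : (maxn 0 b - minn 0 b = b)%N by lia.
    have -> : (K - r = b.+2)%N by lia.
    have -> : (K - r.+1 = b.+1)%N by lia.
    have -> : (K - b = r.+2)%N by lia.
    by ring.
  rewrite modn_small; last lia.
  have -> : (maxn a.+1 b - minn a.+1 b = r.+2)%N by lia.
  have -> : (K - r = b + c.+3)%N by lia.
  have -> : (K - r.+1 = b + c.+2)%N by lia.
  have -> : (K - r.+2 = b + c.+1)%N by lia.
  by ring.
Qed.

Definition trap xi i : bool := height xi i < 0.
Definition live xi k : bool := height xi k == 1.

Definition trap_energy xi i : nat := \sum_(k < K) live xi k * parabola k i.
Definition energy xi : nat := \sum_(i < K) trap xi i * trap_energy xi i.

Lemma energy_le xi : (energy xi <= K ^ 4)%N.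
Proof.
rewrite /energy (_ : K ^ 4 = \sum_(i < K) \sum_(k < K) K ^ 2)%N; last first.
  by rewrite !sum_nat_const card_ord -!expnS.
apply: leq_sum => i _; apply: (@leq_trans (trap_energy xi i)).
  by case: trap; rewrite ?mul1n// mul0n.
apply: leq_sum => k _; case: live; rewrite ?mul0n// mul1n.
exact: parabola_le.
Qed.

Lemma transient_energy xi : transient xi -> (0 < energy xi)%N.
Proof.
case; rewrite /neg_mass /pos_mass oppr_gt0 => neg pos.
have [i xi_i] : exists i, trap xi i.
  apply/existsP; apply: contraLR neg => /existsPn notrap.
  rewrite -leNgt sumr_ge0// => i _; rewrite le_min lexx andbT leNgt.
  exact: notrap.
have [k xi_k] : exists k, live xi k.
  apply/existsP; apply: contraLR pos => /existsPn nolive.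
  by rewrite -leqNgt leqn0 big1// => k _; have := nolive k; rewrite /live => /negbTE ->.
rewrite /energy (bigD1 i)//= xi_i mul1n addn_gt0.
rewrite /trap_energy (bigD1 k)//= xi_k mul1n addn_gt0 parabola_gt0//.
by apply: contraTneq xi_i => <-; rewrite /trap (eqP xi_k).
Qed.

Lemma height_jump xi k l i : height xi l <= 0 -> height (jump xi k l) i =
  if i == k then 0 else if i == l then height xi l + 1 else height xi i.
Proof. by move=> hl; rewrite /height val_jump// ffunE. Qed.

(** No trap is ever created, so only the traps of xi contribute after the jump.
    For such a trap i, the particle leaves k and reappears at l, or disappears
    if l is a trap: the energy varies by at most
    parabola l i - parabola k i. *)
Lemma trap_energy_jump xi k l i : live xi k -> height xi l <= 0 ->
  (trap (jump xi k l) i * trap_energy (jump xi k l) i + trap xi i * parabola k i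
   <= trap xi i * trap_energy xi i + trap xi i * parabola l i)%N.
Proof.
move=> xi_k xi_l.
have kl : k != l by apply: contraTneq xi_l => <-; rewrite (eqP xi_k).
have -> : (trap (jump xi k l) i : nat) = (trap (jump xi k l) i * trap xi i)%N.
  rewrite /trap height_jump//; case: eqP => // _; case: eqP => [->|_].
    by case: (ltP (height xi l) 0) => ?; rewrite ?muln1// muln0; lia.
  by case: ltP.
case: (trap xi i); rewrite ?muln0 ?mul0n// muln1 !mul1n.
apply: (@leq_trans (trap_energy (jump xi k l) i + parabola k i)).
  by rewrite leq_add2r; case: trap; rewrite ?mul1n// mul0n.
rewrite /trap_energy (bigD1 k)//= (bigD1 l) 1?eq_sym//=.
rewrite [X in (_ <= X + _)%N](bigD1 k)//= xi_k mul1n.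
rewrite [X in (_ <= _ + X + _)%N](bigD1 l) 1?eq_sym//=.
rewrite {1}/live height_jump// eqxx mul0n add0n.
rewrite [X in (_ + X + _ <= _)%N](eq_bigr (fun j => live xi j * parabola j i)%N).
  by case: (live (jump xi k l) l); lia.
by move=> j /andP[jk jl]; rewrite /live height_jump// (negbTE jk) (negbTE jl).
Qed.

(** A sum of antisymmetric currents over the oriented edges of the ring: the
    two orientations of each edge cancel. This holds for K <= 2 as well, where
    the two neighbours coincide. *)
Lemma big_ordS_pred (V : zmodType) (F : 'I_K -> 'I_K -> V) :
  (forall k l, F k l = - F l k) ->
  \sum_(k < K) (F k (ordS k) + F k (ord_pred k)) = 0.
Proof.
move=> FN; rewrite big_split /=.
have ordS_inj : injective (@ordS K) by exact: can_inj (@ordSK K).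
have -> : \sum_k F k (ord_pred k) = \sum_k F (ordS k) k.
  by rewrite (reindex_inj ordS_inj); apply: eq_bigr => k _; rewrite ordSK.
rewrite -big_split big1 //= => k _.
by rewrite (FN k (ordS k)) addNr.
Qed.

(** With eta the indicator of live particles, the jump rate from k to l is
    eta k (1 - eta l). For each trap i, expanding 1 - eta l leaves the free
    Laplacian of the weight, as the quadratic part in eta is antisymmetric; this
    Laplacian is -2 at every live site since i itself is not live. *)
Lemma generator_energy (R : realType) xi :
  SWT_generator (fun z => (energy z)%:R : R) xi
    <= - (2 / K%:R ^+ 2) * (energy xi)%:R.
Proof.
pose tau i : R := (trap xi i)%:R; pose eta k : R := (live xi k)%:R.
pose phi k i : R := (parabola k i)%:R.
have rate k l (c : R) : ((height xi k == 1) && (height xi l <= 0))%:R * c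
    = eta k * (1 - eta l) * c.
  rewrite /eta /live; have /forallP/(_ l) := valP xi; rewrite -/(height xi l) => hl.
  case: (height xi k == 1); rewrite ?mul0r//= mul1r; congr (_ * c).
  have [->|] := eqVneq (height xi l) 1; first by rewrite subrr.
  move=> l1; rewrite subr0; suff -> : height xi l <= 0 by [].
  by lia.
have energyE z : (energy z)%:R =
    \sum_(i < K) (trap z i * trap_energy z i)%:R :> R by rewrite natr_sum.
have jump_le k l : eta k * (1 - eta l) * ((energy (jump xi k l))%:R - (energy xi)%:R)
    <= \sum_(i < K) tau i * (eta k * (1 - eta l) * (phi l i - phi k i)).
  under eq_bigr do rewrite -rate.
  rewrite -rate; case: (boolP (_ && _)) => [/andP[xi_k xi_l]|_]; last first.
    by rewrite mul0r big1// => i _; rewrite mul0r mulr0.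
  rewrite mul1r !energyE -sumrB ler_sum// => i _.
  rewrite [(trap xi i * _)%:R]natrM -/(tau i).
  rewrite mul1r; have := trap_energy_jump i xi_k xi_l.
  rewrite -(ler_nat R) !natrD !(natrM _ (trap xi i)) -/(tau i) -!/(phi _ _).
  lra.
have at_trap i : tau i * (\sum_(k < K)
      (eta k * (1 - eta (ordS k)) * (phi (ordS k) i - phi k i) +
       eta k * (1 - eta (ord_pred k)) * (phi (ord_pred k) i - phi k i)))
    <= - (2 / K%:R ^+ 2) * (trap xi i * trap_energy xi i)%:R.
  rewrite natrM -/(tau i) mulrCA.
  have [ti|ti] := boolP (trap xi i); last by rewrite /tau (negbTE ti) !mul0r.
  rewrite /tau ti !mul1r.
  have anti := @big_ordS_pred R (fun k l => eta k * eta l * (phi l i - phi k i)).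
  rewrite -[leLHS]addr0 -[X in _ + X]anti; last by move=> k l; ring.
  rewrite -big_split /= /trap_energy natr_sum mulr_sumr.
  apply: ler_sum => k _; rewrite natrM -/(eta k) -/(phi k i).
  have [ki|ki] := eqVneq k i.
    have -> : eta k = 0.
      rewrite /eta /live ki; move: ti; rewrite /trap.
      by case: eqP => // ->.
    by rewrite !mul0r !mulr0 !addr0.
  have lap : phi (ordS k) i + phi (ord_pred k) i + 2 = 2 * phi k i.
    by rewrite /phi -!natrD parabola_laplacian// natrM.
  have phi_le : 2 / K%:R ^+ 2 * phi k i <= 2.
    rewrite mulrAC ler_pdivrMr ?ler_pM2l -?natrX ?ler_nat ?ltr0n ?parabola_le//.
    by rewrite expn_gt0 (leq_trans _ (ltn_ord k)).
  have eta0 : 0 <= eta k by rewrite /eta.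
  have := ler_wpM2l eta0 phi_le.
  have -> : phi (ordS k) i = 2 * phi k i - 2 - phi (ord_pred k) i by lra.
  move=> h; lra.
rewrite energyE mulr_sumr.
apply: le_trans (ler_sum _ (fun i _ => at_trap i)).
rewrite /SWT_generator; under [leRHS]eq_bigr do rewrite mulr_sumr.
rewrite exchange_big /=; apply: ler_sum => k _.
rewrite big_cons big_seq1 !rate.
under [leRHS]eq_bigr do rewrite mulrDr.
by rewrite big_split /= lerD.
Qed.

End Lyapunov.

(** * Uniform bound on the transience probability *)

Lemma transient_two_sites K (xi : conf K) : transient xi -> (1 < K)%N.
Proof.
move=> /transient_energy; apply: contraLR; rewrite -!leqNgt => K1.
rewrite leqn0; apply/eqP; rewrite /energy big1// => i _.
rewrite /trap_energy big1 ?muln0// => k _.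
suff -> : k = i by rewrite parabola_id muln0.
by apply: val_inj => /=; have := ltn_ord k; have := ltn_ord i; lia.
Qed.

Lemma transience_prob_le (R : realType) (d : measure_display)
    (Omega : measurableType d) K (P : conf K -> probability Omega R)
    (X : R -> Omega -> conf K) xi (t : R) : is_SWT P X -> 0 <= t ->
  (transience_prob P X xi t <= (expR (- (2 / K%:R ^+ 2 * t)) * K%:R ^+ 4)%:E)%E.
Proof.
move=> XP t0; have mA := mp_measurable XP transient t0.
have lam0 : 0 <= 2 / K%:R ^+ 2 :> R by rewrite divr_ge0// exprn_ge0.
have decay := exponential_decay XP xi lam0 t0 energy_le (@generator_energy K R).
apply: (@le_trans _ _ (\int[P xi]_w (energy (X t w))%:R%:E)%E); last first.
  apply: le_trans decay _.
  by rewrite lee_fin ler_wpM2l ?expR_ge0// -natrX ler_nat energy_le.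
have -> : transience_prob P X xi t =
    (\int[P xi]_w (\1_(X t @^-1` transient) w)%:E)%E.
  by rewrite integral_indic// setIT.
apply: ge0_le_integral => //.
- by apply/measurable_EFinP; exact: measurable_indic.
- exact: (measurable_observable XP energy t0).
- move=> w _; rewrite indicE lee_fin ler_nat.
  have [|] := boolP (w \in _) => //; rewrite inE /=.
  exact: transient_energy.
Qed.

Theorem theorem1p1 (R : realType) (d : nat -> measure_display)
  (Omega : forall K : nat, measurableType (d K))
  (P : forall K : nat, conf K -> probability (Omega K) R)
  (X : forall K : nat, R -> Omega K -> conf K)
  (hX : forall K : nat, (1 <= K)%N -> is_SWT (P K) (X K)) :
  ereal_sup [set max_transience_prob (P K) (X K)
                   (t * K%:R ^+ 2 * ln K%:R) | K in [set K | (1 <= K)%N]]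
    @[t --> +oo] --> 0%E.
Proof.
have ln2_gt0 : 0 < ln 2 :> R by rewrite ln_gt0// ltr1n.
apply: (@squeeze_cvge _ _ _ _ (cst 0%E) _
    (fun t => (expR (- (t * ln 2)))%:E)); last 2 first.
- exact: cvg_cst.
- apply: cvg_EFin; first by near=> t.
  apply: (@cvg_comp _ _ _ (fun t => t * ln 2) (fun u => expR (- u)) _ +oo).
    by apply: (gt0_cvgMly ln2_gt0); exact: cvg_id.
  exact: cvgr_expR.
near=> t; have t4 : 4 <= t by near: t; exact: nbhs_pinfty_ge.
apply/andP; split.
  have empty_conf : conf 1.
    by exists [ffun=> 0]; apply/forallP => k; rewrite ffunE.
  apply: le_trans (ereal_sup_ubound _); last by exists 1%N.
  rewrite /max_transience_prob.
  apply: le_trans (ereal_sup_ubound _); last by exists empty_conf.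
  exact: measure_ge0.
apply: ge_ereal_sup => _ [K /= K1 <-]; apply: ge_ereal_sup => _ [xi _ <-].
have [{}K1|K_gt1] := leqP K 1.
  rewrite /transience_prob (_ : _ @^-1` _ = set0) ?measure0 ?lee_fin ?expR_ge0//.
  by apply/seteqP; split => // w /= /transient_two_sites; rewrite ltnNge K1.
have K0 : 0 < K%:R :> R by rewrite ltr0n.
have lnK_ge : ln 2 <= ln K%:R :> R by rewrite ler_ln ?posrE// ler_nat.
have s0 : 0 <= t * K%:R ^+ 2 * ln K%:R.
  by rewrite !mulr_ge0 ?exprn_ge0//; lra.
apply: le_trans (transience_prob_le xi (hX K K1) s0) _.
rewrite lee_fin -[X in _ * X ^+ 4](lnK (_ : K%:R \is Num.pos)) ?posrE//.
rewrite -expRM_natl -expRD ler_expR.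
have -> : 2 / K%:R ^+ 2 * (t * K%:R ^+ 2 * ln K%:R) = 2 * t * ln K%:R.
  by field; rewrite gt_eqF.
(* The exponent is (4 - 2 * t) * ln K, and 4 - 2 * t <= - t. *)
nra.
Unshelve. all: by end_near.
Qed.
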